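(* Let $r\ge 2$, $m\ge 1$, and consider a balanced (tenable) $r$-color urn model with multiple drawings consisting of ordered samples of size $m$, with ball replacement matrix $M=(\mathbf{a}_{\mathbf{d}})_{\mathbf{d}\in\mathcal{S}}$ and total balance $\sigma>0$. For each of the two sampling schemes, model $\mathcal{M}_{SEQ}$ (without replacement) and model $\mathcal{R}_{SEQ}$ (with replacement), the urn model is linear if and only if for all $\mathbf{k}\in\Delta$ \[ \sum_{\substack{\mathbf{d}\in\mathcal{S}\\ \mathbf{j}(\mathbf{d})=\mathbf{k}}}\mathbf{a}_{\mathbf{d}}=\sum_{i=1}^{r}\binom{m-1}{\mathbf{k}-\mathbf{e}_i}\,\mathbf{a}_{i\cdot\boldsymbol{1}} . \] In that case, for both sampling schemes, with or without replacement, the identity \[ \mathbb{E}[\mathbf{X}_n\mid\mathcal{F}_{n-1}]=\mathbf{X}_{n-1}\cdot\Big(I+\frac{1}{T_{n-1}}\cdot A\Big) \] holds for all $n\ge 1$, where $I$ is the $r\times r$ identity matrix and $A=(\mathbf{a}_{i\cdot\boldsymbol{1}})_{1\le i\le r}$ is the reduced $r\times r$ matrix, i.e. the matrix whose $i$-th row is $\mathbf{a}_{i\cdot\boldsymbol{1}}$.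
   Context: Vectors are row vectors; $\mathbf{e}_i$ is the $i$-th unit vector of $\mathbb{R}^r$. Let $\Delta=\{\mathbf{k}=(k_1,\dots,k_r)\in\mathbb{Z}^r : k_i\ge 0,\ \sum_{i=1}^r k_i=m\}$ and $\mathcal{S}=\{\mathbf{d}=(d_1,\dots,d_m): 1\le d_i\le r,\ 1\le i\le m\}$. For $\mathbf{d}\in\mathcal{S}$ let $\mathbf{j}(\mathbf{d})=(j_1(\mathbf{d}),\dots,j_r(\mathbf{d}))\in\Delta$ be the vector of multiplicities, $j_\ell(\mathbf{d})=\#\{i: d_i=\ell\}$. For a color $i$, $i\cdot\boldsymbol{1}=(i,i,\dots,i)\in\mathcal{S}$ denotes the constant sequence of length $m$. Write $x^{\underline{k}}=x(x-1)\cdots(x-k+1)$; $\binom{m-1}{\mathbf{l}}=\frac{(m-1)!}{l_1!\cdots l_r!}$ is the multinomial coefficient, equal to $0$ if some $l_j<0$; also $0^0=1$. Urn model (ordered samples). The urn contains balls of $r$ colors. The composition after $n$ draws is $\mathbf{X}_n=(X_n^{(1)},\dots,X_n^{(r)})$, where $X_n^{(i)}$ is the number of balls of color $i$; the initial composition $\mathbf{X}_0$ is a non-random vector of nonnegative integers, and $T_n=\sum_{i=1}^r X_n^{(i)}$. At each step $n\ge 1$ an ordered sample of $m$ balls is drawn, its colors are observed, the sample is returned to the urn, and if the sequence of observed colors is $\mathbf{d}=(d_1,\dots,d_m)\in\mathcal{S}$, then the vector $\mathbf{a}_{\mathbf{d}}\in\mathbb{Z}^r$ is added to the composition: $\mathbf{X}_n=\mathbf{X}_{n-1}+\mathbf{a}_{\mathbf{d}}$.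 The ball replacement matrix is $M=(\mathbf{a}_{\mathbf{d}})_{\mathbf{d}\in\mathcal{S}}$. $\mathcal{F}_n$ is the sigma-algebra generated by the first $n$ draws. Conditionally on $\mathcal{F}_{n-1}$, the probability that the $n$-th sample is the sequence $\mathbf{d}$ is: - model $\mathcal{M}_{SEQ}$ (without replacement): $\prod_{\ell=1}^r (X_{n-1}^{(\ell)})^{\underline{j_\ell(\mathbf{d})}}\big/ (T_{n-1})^{\underline{m}}$; - model $\mathcal{R}_{SEQ}$ (with replacement): $\prod_{\ell=1}^r (X_{n-1}^{(\ell)})^{j_\ell(\mathbf{d})}\big/ (T_{n-1})^{m}$. Balanced: there is a constant integer $\sigma>0$ (the total balance) such that for every $\mathbf{d}\in\mathcal{S}$ the entries of $\mathbf{a}_{\mathbf{d}}$ sum to $\sigma$. Hence $T_n=n\sigma+T_0$ is deterministic. Tenability (standing assumption). Writing $\mathbf{a}_{\mathbf{d}}=(a_1,\dots,a_r)$ and $\mathbf{k}=\mathbf{j}(\mathbf{d})$: for model $\mathcal{M}_{SEQ}$, $a_i\ge -k_i$ for all $i$ and all $\mathbf{d}\in\mathcal{S}$; for model $\mathcal{R}_{SEQ}$, $a_i\ge -1$ if $k_i>0$ and $a_i\ge 0$ if $k_i=0$. The initial total satisfies $T_0\ge m$ for model $\mathcal{M}_{SEQ}$ and $T_0\ge 1$ for model $\mathcal{R}_{SEQ}$ so that sampling is possible; such totals $T_0$ are called admissible. Linear: an urn model (given by $M$ and the sampling scheme) is called linear if for every admissible total $T_0$ there exist real $r\times r$ matrices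 $(C_n)_{n\ge 1}$, not depending on the composition of the urn, such that for every initial composition $\mathbf{X}_0$ with total $T_0$ one has $\mathbb{E}[\mathbf{X}_n\mid\mathcal{F}_{n-1}]=\mathbf{X}_{n-1}\cdot C_n$ for all $n\ge 1$. *)

(* Defs.v *)
From HB Require Import structures.
From mathcomp Require Import all_boot all_order all_algebra.
From mathcomp Require Import all_classical all_reals all_analysis.

Set Implicit Arguments.
Unset Strict Implicit.
Unset Printing Implicit Defensive.

Import Order.TTheory GRing.Theory Num.Theory.
Import numFieldNormedType.Exports.

Local Open Scope classical_set_scope.
Local Open Scope ring_scope.

Section Conditional_expectation.
Context {R : realType} {disp : measure_display} {Omega : measurableType disp}.
Variables (P : probability Omega R) (G : set (set Omega)).

(* Y is a version of E[X | G]. As conditional expectations are only defined up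
   to almost sure equality, an identity E[X | G] = Y with Y G-measurable is
   rendered by this predicate. G is meant to be a sub-sigma-algebra. *)
Definition is_cond_exp (X Y : Omega -> R) : Prop :=
  [/\ P.-integrable setT (EFin \o X),
      P.-integrable setT (EFin \o Y),
      (forall B : set R, measurable B -> G (Y @^-1` B)) &
      (forall A : set Omega, G A ->
         (\int[P]_(w in A) (Y w)%:E = \int[P]_(w in A) (X w)%:E)%E)].

Definition is_cond_exp_row (r : nat) (X Y : Omega -> 'rV[R]_r) : Prop :=
  forall i : 'I_r, is_cond_exp (fun w => X w 0 i) (fun w => Y w 0 i).

End Conditional_expectation.

Definition sample (r m : nat) : finType := {ffun 'I_m -> 'I_r}.

Definition const_sample (r m : nat) (i : 'I_r) : sample r m := [ffun=> i].

Definition multiplicity (r m : nat) (d : sample r m) (l : 'I_r) : nat :=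
  #|[set i : 'I_m | d i == l]%SET|.

Definition jvec (r m : nat) (d : sample r m) : 'rV[int]_r :=
  \row_l (multiplicity d l)%:Z.

Definition total_balls (r : nat) (x : 'rV[int]_r) : int := \sum_(i < r) x 0 i.

Definition nonneg_row (r : nat) (x : 'rV[int]_r) : Prop := forall i, 0 <= x 0 i.

Definition Delta (r m : nat) (k : 'rV[int]_r) : Prop :=
  nonneg_row k /\ total_balls k = m%:Z.

Definition unit_row (r : nat) (i : 'I_r) : 'rV[int]_r := delta_mx 0 i.

(* Meant for l with total n; the integer quotient is then exact when l >= 0. *)
Definition multinomial (r : nat) (n : nat) (l : 'rV[int]_r) : nat :=
  if [forall j, 0 <= l 0 j]
  then (n`! %/ \prod_(j < r) `|l ord0 j| `!)%N
  else 0%N.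

Definition falling {K : pzRingType} (x : K) (k : nat) : K :=
  \prod_(i < k) (x - i%:R).

Variant scheme := without_replacement | with_replacement.

Definition draw_prob (R : realType) (s : scheme) (r m : nat)
    (x : 'rV[int]_r) (d : sample r m) : R :=
  match s with
  | without_replacement =>
      (\prod_(l < r) falling (x 0 l)%:~R (multiplicity d l))
      / falling (total_balls x)%:~R m
  | with_replacement =>
      (\prod_(l < r) (x 0 l)%:~R ^+ multiplicity d l) / (total_balls x)%:~R ^+ m
  end.

Definition balanced (r m : nat) (a : sample r m -> 'rV[int]_r) (sigma : int) :
  Prop := forall d, total_balls (a d) = sigma.

Definition tenable (s : scheme) (r m : nat) (a : sample r m -> 'rV[int]_r) :
    Prop :=
  match s with
  | without_replacement => forall d i, - (multiplicity d i)%:Z <= a d 0 i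
  | with_replacement => forall d i,
      ((0 < multiplicity d i)%N -> -1 <= a d 0 i) /\
      (multiplicity d i = 0%N -> 0 <= a d 0 i)
  end.

Definition admissible (s : scheme) (m : nat) (T0 : int) : Prop :=
  match s with
  | without_replacement => m%:Z <= T0
  | with_replacement => 1 <= T0
  end.

Section Urn.
Context {R : realType} {disp : measure_display} {Omega : measurableType disp}.
Variables (r m : nat).

(* Draws are indexed from 0: D n is the sample drawn at step n.+1. *)
Implicit Type D : nat -> Omega -> sample r m.

Definition composition (a : sample r m -> 'rV[int]_r) (X0 : 'rV[int]_r)
    D (n : nat) (w : Omega) : 'rV[int]_r :=
  X0 + \sum_(k < n) a (D k w).

Definition draws_filtration D (n : nat) : set (set Omega) :=
  <<s [set A | exists2 k, (k < n)%N & exists d, A = D k @^-1` [set d]] >>.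

Record urn_process (P : probability Omega R) (s : scheme)
    (a : sample r m -> 'rV[int]_r) (X0 : 'rV[int]_r) D : Prop := UrnProcess {
  urn_init_nonneg : nonneg_row X0 ;
  urn_init_admissible : admissible s m (total_balls X0) ;
  urn_draw_measurable : forall n d, measurable (D n @^-1` [set d]) ;
  urn_draw_law : forall n d,
    is_cond_exp P (draws_filtration D n)
      (\1_(D n @^-1` [set d]) : Omega -> R)
      (fun w => draw_prob R s (composition a X0 D n w) d)
}.

End Urn.

Definition real_row (R : realType) (r : nat) (x : 'rV[int]_r) : 'rV[R]_r :=
  map_mx intr x.

Definition linear_urn (R : realType) (s : scheme) (r m : nat)
    (a : sample r m -> 'rV[int]_r) : Prop :=
  forall T0 : int, admissible s m T0 ->
  exists C : nat -> 'M[R]_r,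
  forall X0 : 'rV[int]_r, nonneg_row X0 -> total_balls X0 = T0 ->
  forall (disp : measure_display) (Omega : measurableType disp)
         (P : probability Omega R) (D : nat -> Omega -> sample r m),
  urn_process P s a X0 D ->
  forall n : nat,
  is_cond_exp_row P (draws_filtration D n)
    (fun w => real_row R (composition a X0 D n.+1 w))
    (fun w => real_row R (composition a X0 D n w) *m C n.+1).

Definition reduced_mx (R : realType) (r m : nat)
    (a : sample r m -> 'rV[int]_r) : 'M[R]_r :=
  \matrix_(i < r) real_row R (a (const_sample m i)).

(* Main.v *)
(* A sample [d] is drawn with probability [weight d / stepfall T m], where the
   weight depends on [d] only through [jvec d], and the weights satisfy a
   Vandermonde identity; hence the first ball of an ordered sample is uniformly
   distributed over the urn in both schemes. Consequently the grouped-sum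
   condition, which says that replacing [a d] by [a (const (d ord0))] changes no
   sum over a class of [jvec], makes the mean drift equal to [x *m A / T].
   Conversely, if the drift is [x *m K] for all urns [x] with total [T], the
   one-colour urns force [K = A / T], and the condition follows because the
   weights attached to distinct values of [jvec] are linearly independent as
   functions of [x]. That linearity constrains every [x] requires an urn process
   started at [x]; it is realised on [0, 1[ with Lebesgue measure. *)

Require Import Defs.
From HB Require Import structures.
From mathcomp Require Import all_boot all_order all_algebra.
From mathcomp Require Import all_classical all_reals all_analysis.
From mathcomp Require Import measurable_realfun ring zify.

Import Order.TTheory GRing.Theory Num.Theory.
Import numFieldNormedType.Exports.

Local Open Scope classical_set_scope.
Local Open Scope ring_scope.

Set Implicit Arguments.
Unset Strict Implicit.
Unset Printing Implicit Defensive.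

(** * Counting samples by multiplicities *)

Lemma total_balls_unit (r : nat) (t : int) (i : 'I_r) :
  total_balls (t *: unit_row i) = t.
Proof.
rewrite /total_balls (bigD1 i)//= !mxE !eqxx mulr1 big1 ?addr0// => l.
by rewrite !mxE => /negbTE ->; rewrite mulr0.
Qed.

Lemma total_ballsD (r : nat) (x y : 'rV[int]_r) :
  total_balls (x + y) = total_balls x + total_balls y.
Proof. by rewrite -big_split; apply: eq_bigr => i _; rewrite mxE. Qed.

Lemma total_ballsB_unit (r m : nat) (k : 'rV[int]_r) i :
  total_balls k = m.+1%:Z -> total_balls (k - unit_row i) = m%:Z.
Proof.
move=> tk; apply: (@addIr _ 1).
by rewrite -[X in _ + X](total_balls_unit 1 i) scale1r -total_ballsD subrK tk
  intS addrC.
Qed.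

Section Words.
Variables r m : nat.
Implicit Types (l : 'I_r) (d : sample r m).

Lemma multiplicityE d l : multiplicity d l = (\sum_i (d i == l))%N.
Proof.
rewrite /multiplicity -sum1dep_card big_mkcond /=.
by apply: eq_bigr => i _; case: (d i == l).
Qed.

Lemma sum_multiplicity d : (\sum_l multiplicity d l)%N = m.
Proof.
under eq_bigr do rewrite multiplicityE.
rewrite exchange_big /= (eq_bigr (fun _ => 1%N)) ?sum1_card ?card_ord// => i _.
rewrite (bigD1 (d i))//= eqxx big1 ?addn0// => l /negbTE.
by rewrite eq_sym => ->.
Qed.

Lemma Delta_jvec d : Delta m (jvec d).
Proof.
split=> [i|]; rewrite ?mxE//.
rewrite /total_balls (eq_bigr (fun l => (multiplicity d l)%:Z)) => [|l _].
  by rewrite -(big_morph Posz PoszD (erefl 0%:Z)) sum_multiplicity.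
by rewrite mxE.
Qed.

End Words.

Section ConsSample.
Variables r m : nat.
Implicit Types (l : 'I_r) (d : sample r m).

Definition cons_sample (i : 'I_r) (d : sample r m) : sample r m.+1 :=
  [ffun j => oapp d i (unlift ord0 j)].

Lemma cons_sample0 i d : cons_sample i d ord0 = i.
Proof. by rewrite ffunE unlift_none. Qed.

Lemma cons_sample_lift i d j : cons_sample i d (lift ord0 j) = d j.
Proof. by rewrite ffunE liftK. Qed.

Lemma multiplicity_cons i d l :
  multiplicity (cons_sample i d) l = ((i == l) + multiplicity d l)%N.
Proof.
rewrite !multiplicityE big_ord_recl cons_sample0; congr addn.
by apply: eq_bigr => j _; rewrite cons_sample_lift.
Qed.

Lemma big_cons_sample (V : nmodType) (P : pred (sample r m.+1))
    (F : sample r m.+1 -> V) :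
  \sum_(e | P e) F e =
  \sum_(i < r) \sum_(d | P (cons_sample i d)) F (cons_sample i d).
Proof.
rewrite pair_big_dep /=.
apply: (reindex (fun p : 'I_r * sample r m => cons_sample p.1 p.2)).
exists (fun e : sample r m.+1 =>
  (e ord0, [ffun j => e (lift ord0 j)] : sample r m)).
  move=> [i d] _ /=; rewrite cons_sample0; congr pair.
  by apply/ffunP => j; rewrite ffunE cons_sample_lift.
move=> e _ /=; apply/ffunP => j; rewrite ffunE.
by case: unliftP => [k ->|->] /=; rewrite ?ffunE.
Qed.

End ConsSample.

Lemma jvec_cons (r m : nat) i (d : sample r m) :
  jvec (cons_sample i d) = unit_row i + jvec d.
Proof.
apply/rowP => l; rewrite !mxE multiplicity_cons PoszD eqxx (eq_sym l) /=.
by case: eqP.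
Qed.

(** Induction on [m] by deleting the first letter [i]: restoring the factor [k_i] turns the count
    for [k - unit_row i] into [k_i * m!], and the [k_i] add up to [m.+1]. *)
Lemma card_jvec (r m : nat) (k : 'rV[int]_r) : Delta m k ->
  (#|[set d : sample r m | jvec d == k]%SET| * \prod_(j < r) `|k ord0 j| `!)%N
  = m`!.
Proof.
rewrite -sum1dep_card; elim: m k => [|m IHm] k [k0 tk].
  have kE j : k 0 j = 0.
    apply/eqP; move: tk => /eqP; rewrite psumr_eq0 => [|i _]; last exact: k0.
    by move=> /allP/(_ j); rewrite mem_index_enum => /(_ isT).
  rewrite (eq_bigl xpredT) => [|d]; last first.
    apply/eqP/rowP => j; rewrite kE mxE; congr Posz.
    by rewrite multiplicityE big_ord0.
  rewrite sum1_card card_ffun !card_ord expn0 mul1n big1// => j _.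
  by rewrite kE.
rewrite (big_cons_sample (V := nat)).
rewrite big_distrl /=.
transitivity (\sum_(i < r) `|k ord0 i| * m`!)%N; last first.
  rewrite -big_distrl /= factS; congr muln; apply/eqP.
  rewrite -eqz_nat (big_morph Posz PoszD (erefl 0%:Z)) -tk.
  apply/eqP/eq_bigr => i _.
  by rewrite gez0_abs// k0.
apply: eq_bigr => i _.
have [ki0|ki] := eqVneq (k 0 i) 0.
  rewrite ki0 mul0n big1 ?mul0n// => d; rewrite jvec_cons => /eqP/rowP/(_ i).
  by rewrite ki0 !mxE !eqxx.
have ki1 : 1 <= k 0 i by rewrite -gtz0_ge1 lt_def ki k0.
rewrite (eq_bigl (fun d => jvec d == k - unit_row i)) => [|d]; last first.
  by rewrite jvec_cons eq_sym addrC -subr_eq eq_sym.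
rewrite -(IHm (k - unit_row i)); last first.
  split=> [j|].
    rewrite !mxE eqxx /=; case: (j =P i) => [->|_]; rewrite ?subr0 ?k0//.
    by rewrite subr_ge0.
  exact: total_ballsB_unit.
rewrite mulnCA; congr muln.
rewrite (bigD1 i)//= [in RHS](bigD1 i)//= mulnA; congr muln.
  rewrite !mxE !eqxx /=.
  case: (k 0 i) ki1 => [[|n]|n]//= _.
  by rewrite subn1 factS.
by apply: eq_bigr => j /negbTE ji; rewrite !mxE ji andbF subr0.
Qed.

(** [l] may have negative entries, as [k - unit_row i] does when [k_i = 0]; then no sample qualifies
    and [multinomial] is 0. *)
Lemma card_jvec_multinomial (r m : nat) (l : 'rV[int]_r) :
  total_balls l = m%:Z ->
  #|[set d : sample r m | jvec d == l]%SET| = multinomial m l.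
Proof.
move=> tl; rewrite /multinomial; case: ifPn => [/forallP l0|/forallPn[j lj]].
  rewrite -(@card_jvec r m l)// mulnK// prodn_gt0// => j.
  exact: fact_gt0.
apply/eqP; rewrite cards_eq0; apply/eqP/setP => d; rewrite !inE.
by apply/negbTE; apply: contra lj => /eqP <-; rewrite mxE.
Qed.

(** Once the first letter is [i], the other letters range over the samples with multiplicities
    [k - unit_row i]. This turns the multinomial sum of the theorem into a sum over a class of
    [jvec]. *)
Lemma sum_first_letter (r m : nat) (V : zmodType) (f : 'I_r -> V)
    (k : 'rV[int]_r) : total_balls k = m.+1%:Z ->
  \sum_(d : sample r m.+1 | jvec d == k) f (d ord0) =
  \sum_(i < r) f i *+ multinomial m (k - unit_row i).
Proof.
move=> tk; rewrite big_cons_sample; apply: eq_bigr => i _.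
rewrite -card_jvec_multinomial; last exact: total_ballsB_unit.
rewrite -sum1dep_card -sumrMnr; apply: eq_big => [d|d _].
  by rewrite jvec_cons [RHS]eq_sym subr_eq eq_sym addrC.
by rewrite cons_sample0.
Qed.

(** * Sampling weights *)

(* Both schemes at once: [c = 1] gives the falling factorial and [c = 0] the
   power. *)
Definition stepfall {K : pzRingType} (c x : K) (k : nat) : K :=
  \prod_(i < k) (x - c *+ i).

Section Weights.
Variables (K : comPzRingType) (r : nat) (c : K).
Implicit Type x : 'I_r -> K.

Lemma stepfallS (x : K) k : stepfall c x k.+1 = x * stepfall c (x - c) k.
Proof.
rewrite /stepfall big_ord_recl mulr0n subr0; congr (_ * _).
by apply: eq_bigr => i _; rewrite /= mulrS opprD addrA.
Qed.

Definition weight m x (d : sample r m) : K :=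
  \prod_(l < r) stepfall c (x l) (multiplicity d l).

Lemma weight_jvec m x (d e : sample r m) :
  jvec d = jvec e -> weight x d = weight x e.
Proof.
move=> /rowP de; apply: eq_bigr => l _.
by have := de l; rewrite !mxE => -[->].
Qed.

(** Chain rule: the first ball has weight [x i] and lowers the count of color [i] by [c] for the
    later draws. *)
Lemma weight_cons m x i (d : sample r m) :
  weight x (cons_sample i d) = x i * weight (fun l => x l - c *+ (i == l)) d.
Proof.
rewrite /weight (bigD1 i)//= [in RHS](bigD1 i)//= mulrA; congr (_ * _).
  by rewrite multiplicity_cons eqxx stepfallS.
apply: eq_bigr => l; rewrite eq_sym => /negbTE il.
by rewrite multiplicity_cons il subr0.
Qed.

(** Multivariate Vandermonde identity. After the first ball the total is [c] less whatever its
    color, so the same factor comes out of every term. *)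
Lemma sum_weight m x :
  \sum_(d : sample r m) weight x d = stepfall c (\sum_i x i) m.
Proof.
elim: m x => [|m IHm] x.
  rewrite /stepfall big_ord0 (eq_bigr (fun=> 1)) => [|d _]; last first.
    rewrite /weight big1// => l _.
    by rewrite multiplicityE big_ord0 /stepfall big_ord0.
  by rewrite sumr_const -[#|_|]/#|sample r 0| card_ffun !card_ord expn0.
rewrite big_cons_sample stepfallS mulr_suml; apply: eq_bigr => i _.
under eq_bigr do rewrite weight_cons.
rewrite -mulr_sumr IHm sumrB; congr (_ * stepfall _ (_ - _) _).
by rewrite (bigD1 i)//= eqxx big1 ?addr0// => l /negbTE; rewrite eq_sym => ->.
Qed.

Lemma sum_weight_first m x (f : 'I_r -> K) :
  \sum_(d : sample r m.+1) weight x d * f (d ord0) =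
  stepfall c (\sum_i x i - c) m * \sum_i x i * f i.
Proof.
rewrite big_cons_sample mulr_sumr; apply: eq_bigr => i _.
under eq_bigr do rewrite weight_cons cons_sample0 mulrAC.
rewrite -mulr_sumr sum_weight sumrB mulrC; congr (stepfall _ (_ - _) _ * _).
by rewrite (bigD1 i)//= eqxx big1 ?addr0// => l /negbTE; rewrite eq_sym => ->.
Qed.

End Weights.

Definition step (K : pzRingType) (s : scheme) : K :=
  if s is without_replacement then 1 else 0.

Lemma draw_probE (R : realType) s r m (x : 'rV[int]_r) (d : sample r m) :
  draw_prob R s x d =
  weight (step R s) (fun l => (x 0 l)%:~R) d /
  stepfall (step R s) (total_balls x)%:~R m.
Proof.
case: s => //=; congr (_ / _).
  apply: eq_bigr => l _; rewrite /stepfall.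
  by under eq_bigr do rewrite mul0rn subr0; rewrite prodr_const card_ord.
by rewrite /stepfall; under eq_bigr do rewrite mul0rn subr0;
  rewrite prodr_const card_ord.
Qed.

Lemma total_ballsE (K : pzRingType) r (x : 'rV[int]_r) :
  (total_balls x)%:~R = \sum_i (x 0 i)%:~R :> K.
Proof. by rewrite /total_balls raddf_sum. Qed.

Lemma stepfall_admissible (R : realType) s m (T : int) : admissible s m T ->
  0 < stepfall (step R s) T%:~R m.
Proof.
move=> aT; apply: prodr_gt0 => i _; case: s aT => /= aT.
  rewrite subr_gt0 -[i%:R]/(i%:Z%:~R) ltr_int (lt_le_trans _ aT)//.
  by rewrite ltz_nat.
by rewrite mul0rn subr0 ltr0z (lt_le_trans _ aT).
Qed.

Lemma admissible_gt0 s m (T : int) : (0 < m)%N -> admissible s m T -> 0 < T.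
Proof. by case: s => /= m0; apply: lt_le_trans. Qed.

Lemma admissible_le s m (T T' : int) :
  T <= T' -> admissible s m T -> admissible s m T'.
Proof. by case: s => /= TT' /le_trans; apply. Qed.

Lemma sum_draw_prob (R : realType) s r m (x : 'rV[int]_r) :
  admissible s m (total_balls x) ->
  \sum_(d : sample r m) draw_prob R s x d = 1.
Proof.
move=> ax; under eq_bigr do rewrite draw_probE.
rewrite -mulr_suml sum_weight -total_ballsE divff// gt_eqF//.
exact: stepfall_admissible.
Qed.

(** The denominator is [T] times the factor contributed by the last [m] balls, so [1 / T] is what
    remains, in both schemes. *)
Lemma draw_prob_first (R : realType) s r m (x : 'rV[int]_r) (f : 'I_r -> R) :
  admissible s m.+1 (total_balls x) ->
  \sum_(d : sample r m.+1) draw_prob R s x d * f (d ord0) =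
  (\sum_i (x 0 i)%:~R * f i) / (total_balls x)%:~R.
Proof.
move=> ax; under eq_bigr do rewrite draw_probE mulrAC.
rewrite -mulr_suml sum_weight_first -total_ballsE.
have := @stepfall_admissible R _ _ _ ax; rewrite stepfallS.
set T := _%:~R; set S := stepfall _ _ _ => TS0.
have /andP[T0 S0] : (T != 0) && (S != 0) by rewrite -negb_or -mulf_eq0 gt_eqF.
by field; rewrite T0 S0.
Qed.

Lemma stepfall_eq0 (R : realType) (s : scheme) (n k : nat) :
  stepfall (step R s) n%:R k = 0 -> (n < k)%N.
Proof.
move=> /eqP; rewrite prodf_seq_eq0 => /hasP[i _ /=]; case: s => /=.
  by rewrite subr_eq0 eqr_nat => /eqP ->.
rewrite mul0rn subr0 pnatr_eq0 => /eqP ->.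
by case: k i => [[]|].
Qed.

(** Without replacement a factor can be negative only if [k > n], and then the factor [n - n] kills
    the product. *)
Lemma stepfall_ge0 (R : realType) (s : scheme) (n k : nat) :
  0 <= stepfall (step R s) n%:R k.
Proof.
case: s; last by apply: prodr_ge0 => i _; rewrite /= mul0rn subr0.
have [kn|nk] := leqP k n.
  apply: prodr_ge0 => i _; rewrite subr_ge0 ler_nat.
  exact: ltnW (leq_trans (ltn_ord i) kn).
by rewrite /stepfall (bigD1 (Ordinal nk))//= subrr mul0r.
Qed.

Lemma stepfall0 (R : realType) (s : scheme) (n k : nat) :
  (s = without_replacement /\ (n < k)%N) \/ (n = 0%N /\ (0 < k)%N) ->
  stepfall (step R s) n%:R k = 0.
Proof.
move=> [[-> nk]|[-> ]].
  by rewrite /stepfall (bigD1 (Ordinal nk))//= subrr mul0r.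
by case: k => // k _; rewrite stepfallS mul0r.
Qed.

Lemma draw_prob_ge0 (R : realType) s r m (x : 'rV[int]_r) (d : sample r m) :
  nonneg_row x -> admissible s m (total_balls x) -> 0 <= draw_prob R s x d.
Proof.
move=> x0 ax; rewrite draw_probE divr_ge0//; last first.
  exact/ltW/stepfall_admissible.
apply: prodr_ge0 => l _.
by rewrite -(gez0_abs (x0 l)) stepfall_ge0.
Qed.

(** A sample of nonzero probability takes no more balls of a color than are present or, with
    replacement, shows only colors that are present. Tenability bounds removals accordingly. *)
Lemma tenable_nonneg (R : realType) s r m (a : sample r m -> 'rV[int]_r)
    (x : 'rV[int]_r) d : tenable s a -> nonneg_row x ->
  draw_prob R s x d != 0 -> nonneg_row (x + a d).
Proof.
move=> ta x0 p0 l; rewrite mxE.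
have : stepfall (step R s) (x 0 l)%:~R (multiplicity d l) != 0.
  apply: contra p0; rewrite draw_probE /weight (bigD1 l)//= => /eqP ->.
  by rewrite !mul0r.
rewrite -(gez0_abs (x0 l)); case: s ta {p0} => /= ta w0.
  suff : (multiplicity d l <= `|x ord0 l|)%N.
    move: (ta d l); move: (a d ord0 l) (multiplicity d l) (absz _) => u k n.
    by lia.
  rewrite leqNgt; apply: contra w0 => nk.
  by apply/eqP/(@stepfall0 _ without_replacement); left.
have [ta1 ta0] := ta d l.
have [/ta0 al|] := posnP (multiplicity d l); first by rewrite addr_ge0.
move=> k0; have al := ta1 k0.
suff : (0 < `|x ord0 l|)%N.
  by move: al; move: (a d ord0 l) (absz _) => u n; lia.
rewrite lt0n; apply: contra w0 => /eqP n0.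
by apply/eqP/(@stepfall0 _ with_replacement); right.
Qed.

(** * Mean drift and linear independence of the weights *)

(** The lowest digit is the residue modulo [b]; the others follow by induction. This separates the
    exponents in [weights_free]. *)
Lemma digits_inj (r b : nat) (f g : 'I_r -> nat) :
  (forall l, (f l < b)%N) -> (forall l, (g l < b)%N) ->
  (\sum_l f l * b ^ l = \sum_l g l * b ^ l)%N -> f =1 g.
Proof.
elim: r f g => [|r IHr] f g fb gb; first by move=> _ [].
have expand h : (\sum_(l < r.+1) h l * b ^ l =
    (\sum_(l < r) h (lift ord0 l) * b ^ l) * b + h ord0)%N.
  rewrite big_ord_recl expn0 muln1 addnC big_distrl; congr addn.
  by apply: eq_bigr => l _; rewrite /= expnSr mulnA.
rewrite !expand => fg.
have b0 : (0 < b)%N := leq_ltn_trans (leq0n _) (fb ord0).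
have fg0 : f ord0 = g ord0.
  by have := congr1 (modn^~ b) fg; rewrite /= !modnMDl !modn_small.
have fgS : f \o lift ord0 =1 g \o lift ord0.
  apply: IHr => [l|l|]; rewrite /= ?fb ?gb//.
  by apply/eqP; move/eqP: fg; rewrite fg0 eqn_add2r eqn_pmul2r.
by move=> l; case: (unliftP ord0 l) => [j ->|->]; [exact: fgS|].
Qed.

(** A nonzero polynomial has fewer roots than its size. Starting at 1 keeps the urns substituted in
    [weights_free] nonempty. *)
Lemma poly_eq0_nat (K : numDomainType) (p : {poly K}) :
  (forall n : nat, p.[n.+1%:R] = 0) -> p = 0.
Proof.
move=> pn; apply/eqP; apply: contraT => p0.
have := @max_poly_roots _ p [seq n.+1%:R | n <- iota 0 (size p)] p0.
rewrite size_map size_iota ltnn; apply.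
  by apply/allP => _ /mapP[n _ ->]; apply/rootP.
rewrite map_inj_uniq ?iota_uniq// => i j /eqP.
by rewrite eqr_nat eqSS => /eqP.
Qed.

Lemma sum_by_jvec (r m : nat) (V : nmodType) (F : sample r m -> V) :
  (forall d : sample r m, \sum_(e | jvec e == jvec d) F e = 0) ->
  \sum_d F d = 0.
Proof.
move=> F0.
(* Classes are represented by sets of samples, since the partition needs a finite index type and
   ['rV[int]_r] is not one. *)
pose cls (d : sample r m) := [set e : sample r m | jvec e == jvec d]%SET.
rewrite (partition_big cls xpredT)//= big1// => S _.
case: (pickP (fun d => cls d == S)) => [d /eqP <-|S0];
  last by rewrite big_pred0.
apply: etrans (F0 d); apply: eq_bigl => e; apply/eqP/eqP => [/setP/(_ e)|ed].
  by rewrite !inE eqxx => /esym/eqP.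
by apply/setP => e'; rewrite !inE ed.
Qed.

Lemma weight_jvec_neq0 (R : realType) (r m : nat) (d : sample r m) :
  weight 1 (fun l => (jvec d 0 l)%:~R) d != 0 :> R.
Proof.
apply/prodf_neq0 => l _; rewrite mxE.
by apply/eqP => /(@stepfall_eq0 _ without_replacement); rewrite ltnn.
Qed.

(** Both multiplicity vectors sum to [m], so if they differ [e] exceeds [d] in some color, whose
    falling factorial vanishes. *)
Lemma weight_jvec_eq0 (R : realType) (r m : nat) (d e : sample r m) :
  jvec d != jvec e -> weight 1 (fun l => (jvec d 0 l)%:~R) e = 0 :> R.
Proof.
move=> de; suff [l dl] : exists l, (multiplicity d l < multiplicity e l)%N.
  rewrite /weight (bigD1 l)//= mxE.
  by rewrite (@stepfall0 _ without_replacement) ?mul0r//; left.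
apply/existsP; apply: contraR de; rewrite negb_exists => /forallP de.
have ed l : (multiplicity e l <= multiplicity d l)%N by rewrite leqNgt.
apply/eqP/rowP => l; rewrite !mxE; congr Posz; apply/esym/eqP.
have /leqif_sum : forall l, xpredT l -> (multiplicity e l <= multiplicity d l
   ?= iff (multiplicity e l == multiplicity d l))%N by move=> i _; split.
by rewrite !sum_multiplicity => -[_]; rewrite eqxx => /esym/forallP/(_ l).
Qed.

(* With replacement, substituting [n ^ (m.+1 ^ l)] for the [l]-th variable turns
   distinct monomials of degree [m] into distinct powers of [n]. *)
Lemma weights_free (R : realType) s (r m : nat) (g : sample r m -> R) :
  (0 < r)%N ->
  (forall x : 'rV[int]_r, nonneg_row x -> admissible s m (total_balls x) ->
    \sum_d weight (step R s) (fun l => (x 0 l)%:~R) d * g d = 0) ->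
  forall d : sample r m, \sum_(e | jvec e == jvec d) g e = 0.
Proof.
move=> r0; case: s => /= H d.
  (* Without replacement, evaluating at the urn [jvec d], which has exactly [m] balls, leaves only
     the terms of the class of [d]. *)
  have [d0 dt] := Delta_jvec d.
  have /eqP := H (jvec d) d0 (eq_ind_r (fun t => m%:Z <= t) (lexx _) dt).
  rewrite (bigID (fun e => jvec e == jvec d))/=.
  rewrite [X in _ + X]big1 ?addr0 => [|e]; last first.
    by rewrite eq_sym => /(weight_jvec_eq0 R) ->; rewrite mul0r.
  rewrite (eq_bigr (fun e => weight 1 (fun l => (jvec d 0 l)%:~R) d * g e)).
    by rewrite -mulr_sumr mulf_eq0 (negbTE (weight_jvec_neq0 R d)) => /eqP.
  by move=> e /eqP ed; rewrite (weight_jvec 1 _ ed).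
pose deg (e : sample r m) := (\sum_l multiplicity e l * m.+1 ^ l)%N.
(* Multiplicities are at most [m], hence digits in base [m.+1], so the degree determines [jvec]. *)
have mult_le (e : sample r m) l : (multiplicity e l < m.+1)%N.
  by rewrite ltnS -[leqRHS](sum_multiplicity e) (bigD1 l)//= leq_addr.
have degP e : (deg e == deg d) = (jvec e == jvec d).
  apply/eqP/eqP => [ed|/rowP ed].
    by apply/rowP => l; rewrite !mxE; congr Posz; exact: (digits_inj _ _ ed).
  by apply: eq_bigr => l _; have := ed l; rewrite !mxE => -[->].
pose p : {poly R} := \sum_e g e *: 'X^(deg e).
suff p0 : p = 0.
  apply: (@etrans _ _ p`_(deg d)); last by rewrite p0 coef0.
  rewrite coef_sum.
  rewrite big_mkcond/=; apply: eq_bigr => e _.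
  rewrite coefZ coefXn -degP (eq_sym (deg d)).
  by case: eqP; rewrite (mulr1, mulr0).
apply: poly_eq0_nat => n; rewrite horner_sum.
pose x : 'rV[int]_r := \row_l (n.+1 ^ (m.+1 ^ l))%N%:Z.
have x0 l : 1 <= x 0 l by rewrite mxE lez_nat expn_gt0.
rewrite -[RHS](H x); last 2 first.
- by move=> l; apply: le_trans (x0 l).
- rewrite /total_balls (bigD1 (Ordinal r0))//= (le_trans (x0 (Ordinal r0)))//.
  by rewrite lerDl sumr_ge0// => l _; apply: le_trans (x0 l).
apply: eq_bigr => e _; rewrite hornerZ hornerXn mulrC; congr (_ * _).
rewrite /weight /deg -natrX expn_sum natr_prod; apply: eq_bigr => l _.
rewrite /stepfall; under [RHS]eq_bigr do rewrite mul0rn subr0.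
by rewrite prodr_const card_ord mxE mulnC expnM -natrX.
Qed.

(** By [sum_first_letter] both forms compare the same class sums. An empty class makes both sides 0,
    so no sample realising [k] has to be constructed. *)
Lemma grouped_sumsP (r m : nat) (a : sample r m.+1 -> 'rV[int]_r) :
  (forall k : 'rV[int]_r, Delta m.+1 k ->
     \sum_(d | jvec d == k) a d =
     \sum_(i < r)
       a (const_sample m.+1 i) *+ multinomial (m.+1 - 1) (k - unit_row i)) <->
  (forall d : sample r m.+1, \sum_(e | jvec e == jvec d)
     (a e - a (const_sample m.+1 (e ord0))) = 0).
Proof.
rewrite subn1 /=; split=> [H d|H k kD].
  have [_ dt] := Delta_jvec d.
  rewrite sumrB (sum_first_letter (fun i => a (const_sample m.+1 i)) dt).
  by rewrite H ?subrr//; exact: Delta_jvec.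
rewrite -(sum_first_letter (fun i => a (const_sample m.+1 i)) (proj2 kD)).
case: (pickP (fun d : sample r m.+1 => jvec d == k)) => [d /eqP <-|k0].
  by apply/eqP; rewrite -subr_eq0 -sumrB H.
by rewrite !big_pred0.
Qed.

Lemma real_row0 (R : realType) r : real_row R (0 : 'rV[int]_r) = 0.
Proof. exact: map_mx0. Qed.

Lemma real_rowB (R : realType) r (x y : 'rV[int]_r) :
  real_row R (x - y) = real_row R x - real_row R y.
Proof. exact: map_mxB. Qed.

Lemma real_rowD (R : realType) r (x y : 'rV[int]_r) :
  real_row R (x + y) = real_row R x + real_row R y.
Proof. exact: map_mxD. Qed.

Lemma real_row_sum (R : realType) r (I : Type) (t : seq I) (P : pred I)
    (F : I -> 'rV[int]_r) :
  real_row R (\sum_(i <- t | P i) F i) = \sum_(i <- t | P i) real_row R (F i).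
Proof. exact: (big_morph _ (@real_rowD R r) (@real_row0 R r)). Qed.

(** [draw_prob] is constant on classes of [jvec], so [a d] may be traded for the constant-sample
    vector of its first ball, whose color is uniform over the urn. *)
Lemma mean_drift (R : realType) s (r m : nat) (a : sample r m.+1 -> 'rV[int]_r)
    (x : 'rV[int]_r) :
  (forall d : sample r m.+1, \sum_(e | jvec e == jvec d)
     (a e - a (const_sample m.+1 (e ord0))) = 0) ->
  admissible s m.+1 (total_balls x) ->
  \sum_d draw_prob R s x d *: real_row R (a d) =
  (total_balls x)%:~R^-1 *: (real_row R x *m reduced_mx R a).
Proof.
move=> H ax.
pose b (d : sample r m.+1) := a (const_sample m.+1 (d ord0)).
transitivity (\sum_d draw_prob R s x d *: real_row R (b d)).
  apply/eqP; rewrite -subr_eq0 -sumrB; apply/eqP/sum_by_jvec => d.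
  rewrite (eq_bigr (fun e => draw_prob R s x d *: real_row R (a e - b e))).
    by rewrite -scaler_sumr -real_row_sum H real_row0 scaler0.
  move=> e /eqP ed; rewrite !draw_probE (weight_jvec _ _ ed) -scalerBr.
  by rewrite real_rowB.
apply/rowP => j; rewrite summxE !mxE.
under eq_bigr do rewrite !mxE.
rewrite (draw_prob_first (fun i => (a (const_sample m.+1 i) 0 j)%:~R) ax).
by rewrite mulrC; congr (_ * _); apply: eq_bigr => i _; rewrite !mxE.
Qed.

Lemma draw_prob_one_color (R : realType) s (r m : nat) (t : int) (i : 'I_r)
    (d : sample r m) :
  draw_prob R s (t *: unit_row i) d != 0 -> d = const_sample m i.
Proof.
rewrite draw_probE mulf_eq0 negb_or => /andP[/prodf_neq0 d0 _].
apply/ffunP => q; rewrite ffunE; apply/eqP; apply: contraT => dq.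
have := d0 (d q) isT; rewrite !mxE (negbTE dq) andbF mulr0.
rewrite (@stepfall0 _ s 0) ?eqxx//; right; split=> //.
by rewrite multiplicityE (bigD1 q)//= eqxx.
Qed.

(* On one-colour urns the law of the sample is a point mass, which forces [K] to
   be the reduced matrix up to the factor [1 / T0]. *)
Lemma linear_drift_grouped_sums (R : realType) s (r m : nat)
    (a : sample r m.+1 -> 'rV[int]_r) : (0 < r)%N ->
  (forall T0, admissible s m.+1 T0 -> exists K : 'M[R]_r,
     forall x : 'rV[int]_r, nonneg_row x -> total_balls x = T0 ->
     \sum_d draw_prob R s x d *: real_row R (a d) = real_row R x *m K) ->
  forall d : sample r m.+1, \sum_(e | jvec e == jvec d)
     (a e - a (const_sample m.+1 (e ord0))) = 0.
Proof.
move=> r0 H d0.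
pose b (d : sample r m.+1) := a (const_sample m.+1 (d ord0)).
suff g0 j : \sum_(e | jvec e == jvec d0) ((a e - b e) 0 j)%:~R = 0 :> R.
  apply/rowP => j; rewrite summxE mxE.
  by apply/eqP; rewrite -(intr_eq0 R) raddf_sum /= g0.
move: d0; apply: (weights_free (s := s)) => // x x0 ax.
have [K HK] := H _ ax.
have T0 : (total_balls x)%:~R != 0 :> R.
  by rewrite intr_eq0 gt_eqF// (admissible_gt0 _ ax).
pose L := K - (total_balls x)%:~R^-1 *: reduced_mx R a.
(* The vectors [b d] alone have drift [y *m A / T], so [L] describes the contribution of
   [a d - b d]. *)
have diff y : nonneg_row y -> total_balls y = total_balls x ->
    \sum_d draw_prob R s y d *: real_row R (a d - b d) = real_row R y *m L.
  move=> y0 yx; rewrite mulmxBr -(HK y)// -scalemxAr.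
  have -> : (total_balls x)%:~R^-1 *: (real_row R y *m reduced_mx R a) =
      \sum_d draw_prob R s y d *: real_row R (b d).
    apply/rowP => l; rewrite summxE !mxE -yx.
    under [RHS]eq_bigr do rewrite !mxE.
    rewrite (draw_prob_first (fun i => (a (const_sample m.+1 i) 0 l)%:~R)).
      by rewrite mulrC; congr (_ * _); apply: eq_bigr => i _; rewrite !mxE.
    by rewrite yx.
  by rewrite -sumrB; apply: eq_bigr => d _; rewrite real_rowB scalerBr.
have L0 : L = 0.
  (* Row [i] is tested on the urn with all balls of color [i]: its total is that of [x], so [K] is
     the same, and [a d = b d] for the only possible sample. *)
  apply/row_matrixP => i; rewrite row0 rowE.
  have xi := total_balls_unit (total_balls x) i.
  apply: (scalerI T0); rewrite scaler0 scalemxAl.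
  have -> : (total_balls x)%:~R *: delta_mx 0 i =
      real_row R (total_balls x *: unit_row i).
    by apply/rowP => l; rewrite !mxE rmorphM /= rmorph_nat.
  rewrite -diff//; last first.
    move=> l; rewrite !mxE mulr_ge0 ?ler0n// sumr_ge0// => l' _; exact: x0.
  apply: big1 => d _.
  have [->|/draw_prob_one_color dE] :=
    eqVneq (draw_prob R s (total_balls x *: unit_row i) d) 0.
    by rewrite scale0r.
  by rewrite /b dE ffunE subrr real_row0 scaler0.
have := diff x x0 erefl; rewrite L0 mulmx0 => /rowP/(_ j).
rewrite summxE mxE => xj.
apply: (@mulIf _ (stepfall (step R s) (total_balls x)%:~R m.+1)^-1).
  by rewrite invr_neq0// gt_eqF// stepfall_admissible.
rewrite mul0r mulr_suml -[RHS]xj; apply: eq_bigr => d _.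
by rewrite draw_probE !mxE mulrAC.
Qed.

(** * Conditional drift of an urn process *)

Section CondExp.
Context {R : realType} {disp : measure_display} {Omega : measurableType disp}.
Variables (P : probability Omega R) (G : set (set Omega)).
Hypothesis Gm : G `<=` measurable.
Local Notation is_ce := (is_cond_exp P (<<s G >>)).

Lemma generated_measurable A : <<s G >> A -> measurable A.
Proof. by apply: smallest_sub => //; exact: sigma_algebra_measurable. Qed.

(** Gives access to the closure rules for measurable functions, with the generated sigma-algebra on
    the domain. *)
Lemma preimage_generatedP (Y : Omega -> R) :
  (forall B : set R, measurable B -> (<<s G >>) (Y @^-1` B)) <->
  measurable_fun setT (Y : g_sigma_algebraType G -> R).
Proof.
split=> [H _ B mB|H B mB]; first by rewrite setTI; exact: H.
by have := H measurableT B mB; rewrite setTI.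
Qed.

Lemma is_cond_exp_refl (X : Omega -> R) : P.-integrable setT (EFin \o X) ->
  measurable_fun setT (X : g_sigma_algebraType G -> R) -> is_ce X X.
Proof. by move=> iX /preimage_generatedP mX; split. Qed.

Lemma is_cond_expZ c X Y : is_ce X Y ->
  is_ce (fun w => c * X w) (fun w => c * Y w).
Proof.
move=> [iX iY /preimage_generatedP mY XY]; split.
- exact: (integrableZl _ c iX).
- exact: (integrableZl _ c iY).
- by apply/preimage_generatedP; exact: measurable_funM.
- move=> A GA; have mA := generated_measurable GA.
  under eq_integral do rewrite EFinM.
  rewrite integralZl//; last exact: integrableS iY.
  under [RHS]eq_integral do rewrite EFinM.
  rewrite [RHS]integralZl//; last exact: integrableS iX.
  by rewrite XY.
Qed.

Lemma is_cond_exp_sum (I : Type) (t : seq I) (X Y : I -> Omega -> R) :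
  (forall i, is_ce (X i) (Y i)) ->
  is_ce (fun w => \sum_(i <- t) X i w) (fun w => \sum_(i <- t) Y i w).
Proof.
move=> XY; split.
- under [X in P.-integrable _ X]funext do rewrite /= -sumEFin.
  by apply: integrable_sum => // i _; have [] := XY i.
- under [X in P.-integrable _ X]funext do rewrite /= -sumEFin.
  by apply: integrable_sum => // i _; have [] := XY i.
- apply/preimage_generatedP; apply: (@measurable_sum _ _ _ _ _ t) => i.
  by apply/preimage_generatedP; have [] := XY i.
- move=> A GA; have mA := generated_measurable GA.
  under eq_integral do rewrite -sumEFin.
  rewrite integral_sum//; last first.
    by move=> i; have [_ iY _ _] := XY i; exact: integrableS iY.
  under [RHS]eq_integral do rewrite -sumEFin.
  rewrite [RHS]integral_sum//; last first.
    by move=> i; have [iX _ _ _] := XY i; exact: integrableS iX.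
  by apply: eq_bigr => i _; have [_ _ _ ->] := XY i.
Qed.

Lemma is_cond_expD X Y X' Y' : is_ce X Y -> is_ce X' Y' ->
  is_ce (fun w => X w + X' w) (fun w => Y w + Y' w).
Proof.
move=> XY XY'.
have := @is_cond_exp_sum bool [:: true; false]
  (fun b => if b then X else X') (fun b => if b then Y else Y').
under [X in is_ce X]funext do rewrite !big_cons big_nil addr0.
under [X in is_ce _ X]funext do rewrite !big_cons big_nil addr0.
by apply; case.
Qed.

End CondExp.

Section UrnDrift.
Context {R : realType} {disp : measure_display} {Omega : measurableType disp}.
Variables (P : probability Omega R) (s : scheme) (r m : nat).
Variables (a : sample r m -> 'rV[int]_r) (X0 : 'rV[int]_r).
Variable D : nat -> Omega -> sample r m.

Lemma compositionS n w :
  composition a X0 D n.+1 w = composition a X0 D n w + a (D n w).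
Proof. by rewrite /composition big_ord_recr /= addrA. Qed.

Lemma total_composition sigma n w : balanced a sigma ->
  total_balls (composition a X0 D n w) = total_balls X0 + sigma *+ n.
Proof.
move=> ba; elim: n => [|n IHn].
  by rewrite /composition big_ord0 addr0 mulr0n addr0.
by rewrite compositionS total_ballsD IHn ba mulrSr addrA.
Qed.

(** The law of an urn process is given on indicators of draws; expanding functions of a draw in them
    lets linearity apply. *)
Lemma sum_indic_draw n w (f : sample r m -> R) :
  \sum_d f d * \1_(D n @^-1` [set d]) w = f (D n w).
Proof.
rewrite (bigD1 (D n w))//= big1 ?addr0 => [|d /eqP dD].
  by rewrite indicE mem_set// mulr1.
by rewrite indicE memNset ?mulr0// => /esym.
Qed.

Lemma real_compositionE n w i : real_row R (composition a X0 D n w) 0 i =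
  (X0 0 i)%:~R +
  \sum_(k < n) \sum_d (a d 0 i)%:~R * \1_(D k @^-1` [set d]) w.
Proof.
rewrite !mxE rmorphD /= summxE rmorph_sum /=; congr (_ + _).
by apply: eq_bigr => k _; rewrite (sum_indic_draw k w (fun d => (a d 0 i)%:~R)).
Qed.

Hypothesis mD : forall n d, measurable (D n @^-1` [set d]).

Let gen n : set (set Omega) :=
  [set A | exists2 k, (k < n)%N & exists d, A = D k @^-1` [set d]].

Lemma draws_measurable n : gen n `<=` measurable.
Proof. by move=> _ [k _ [d ->]]. Qed.

Lemma draws_filtration_event n k d : (k < n)%N ->
  draws_filtration D n (D k @^-1` [set d]).
Proof. by move=> kn; apply: sub_sigma_algebra; exists k => //; exists d. Qed.

(** The composition is an affine combination of indicators of earlier draws, hence integrable and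
    known at time [n]. *)
Lemma is_cond_exp_composition n i :
  is_cond_exp P (draws_filtration D n)
    (fun w => real_row R (composition a X0 D n w) 0 i)
    (fun w => real_row R (composition a X0 D n w) 0 i).
Proof.
under [X in is_cond_exp _ _ X]funext do rewrite real_compositionE.
under [X in is_cond_exp _ _ _ X]funext do rewrite real_compositionE.
apply: (is_cond_expD (@draws_measurable n)).
  apply: is_cond_exp_refl => //; first exact: finite_measure_integrable_cst.
apply: (is_cond_exp_sum (@draws_measurable n)) => k.
apply: (is_cond_exp_sum (@draws_measurable n)) => d.
apply: (is_cond_expZ (@draws_measurable n)).
apply: is_cond_exp_refl; first exact: integrable_indic.
apply: measurable_indic.
exact: draws_filtration_event.
Qed.

Hypothesis law : forall n d,
  is_cond_exp P (draws_filtration D n)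
    (\1_(D n @^-1` [set d]) : Omega -> R)
    (fun w => draw_prob R s (composition a X0 D n w) d).

(** Only [D n] is unknown at time [n]; by linearity each of its indicators is replaced by the
    conditional probability from [law]. *)
Lemma is_cond_exp_next_composition n i :
  is_cond_exp P (draws_filtration D n)
    (fun w => real_row R (composition a X0 D n.+1 w) 0 i)
    (fun w => real_row R (composition a X0 D n w) 0 i +
       (\sum_d draw_prob R s (composition a X0 D n w) d *: real_row R (a d))
         0 i).
Proof.
under [X in is_cond_exp _ _ X]funext => w.
  rewrite compositionS real_rowD mxE [X in _ + X]mxE.
  rewrite -(sum_indic_draw n w (fun d => (a d 0 i)%:~R)).
  over.
under [X in is_cond_exp _ _ _ X]funext => w.
  rewrite summxE.
  under eq_bigr do rewrite !mxE mulrC.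
  over.
apply: (is_cond_expD (@draws_measurable n)).
  exact: is_cond_exp_composition.
apply: (is_cond_exp_sum (@draws_measurable n)) => d.
apply: (is_cond_expZ (@draws_measurable n)).
exact: law.
Qed.

End UrnDrift.

(** * Existence of urn processes *)

Fixpoint history (T S : Type) (D : nat -> T -> S) (n : nat) (w : T) : seq S :=
  if n is k.+1 then D k w :: history D k w else [::].

Lemma size_history (T S : Type) (D : nat -> T -> S) n w :
  size (history D n w) = n.
Proof. by elim: n => //= n ->. Qed.

Section UnitInterval.
Variable R : realType.

(** The measure lives on the whole line, so draws must also be defined at the points outside [[0,
    1[], which carry no mass. *)
Definition unit_prob : set (measurableTypeR R) -> \bar R :=
  mrestr lebesgue_measure (measurable_itv `[(0 : R), 1[).

HB.instance Definition _ := Measure.on unit_prob.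

Lemma unit_probT : unit_prob setT = 1%E.
Proof.
rewrite /unit_prob /mrestr setTI lebesgue_measure_itv /= lte_fin ltr01.
by rewrite sube0.
Qed.

HB.instance Definition _ :=
  Measure_isProbability.Build _ _ _ unit_prob unit_probT.

End UnitInterval.

(* A history [t] (latest draw first) is assigned an interval [cell t] of length
   equal to its probability; the cells of the one-step extensions of [t] tile
   [cell t], so a uniform point of [0, 1[ determines an infinite history. *)
Section Cells.
Variables (R : realType) (S : finType) (q : seq S -> S -> R).
Hypothesis q_ge0 : forall t d, 0 <= q t d.
Hypothesis sum_q : forall t, \sum_d q t d = 1.

(** Distribution function of [q t] in the order of [enum_rank]; it gives the cut points of [cell t],
    relative to its length. *)
Definition cumul t (k : nat) : R := \sum_(e | (enum_rank e < k)%N) q t e.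

Lemma cumulS t d :
  cumul t (enum_rank d).+1 = cumul t (enum_rank d) + q t d.
Proof.
rewrite /cumul (bigD1 d) ?ltnSn//= addrC; congr (_ + _); apply: eq_bigl => e.
rewrite ltnS [RHS]ltn_neqAle andbC; congr (~~ _ && _).
by rewrite -(inj_eq enum_rank_inj).
Qed.

Lemma le_cumul t j k : (j <= k)%N -> cumul t j <= cumul t k.
Proof.
move=> jk; rewrite /cumul [leRHS](bigID (fun e => (enum_rank e < j)%N))/=.
rewrite [X in _ <= X + _](eq_bigl (fun e => (enum_rank e < j)%N)).
  by rewrite lerDl sumr_ge0.
by move=> e; rewrite andb_idl// => /leq_trans; apply.
Qed.

Lemma cumul0 t : cumul t 0 = 0.
Proof. by rewrite /cumul big_pred0. Qed.

Lemma cumul_max t : cumul t #|S| = 1.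
Proof. by rewrite -(sum_q t); apply: eq_bigl => e; rewrite ltn_ord. Qed.

Fixpoint cell_length (t : seq S) : R :=
  if t is d :: t' then cell_length t' * q t' d else 1.

Fixpoint cell_start (t : seq S) : R :=
  if t is d :: t' then
    cell_start t' + cell_length t' * cumul t' (enum_rank d)
  else 0.

Definition cell t : set R :=
  `[cell_start t, cell_start t + cell_length t[.

Lemma cell_length_ge0 t : 0 <= cell_length t.
Proof. by elim: t => //= d t IHt; rewrite mulr_ge0. Qed.

Lemma cell_consP d t x : cell (d :: t) x <->
  cell_start t + cell_length t * cumul t (enum_rank d) <= x <
  cell_start t + cell_length t * cumul t (enum_rank d).+1.
Proof.
by rewrite /cell /= in_itv /= cumulS mulrDr -addrA.
Qed.

Lemma cell_cons_sub d t : cell (d :: t) `<=` cell t.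
Proof.
move=> x /cell_consP/andP[dx xd]; rewrite /cell /= in_itv /=.
apply/andP; split.
  apply: le_trans dx; rewrite lerDl mulr_ge0 ?cell_length_ge0//.
  by rewrite -(cumul0 t) le_cumul.
apply: lt_le_trans xd _; rewrite lerD2l ler_piMr ?cell_length_ge0//.
by rewrite -(cumul_max t) le_cumul.
Qed.

Lemma cell_sub_unit t : cell t `<=` cell [::].
Proof. by elim: t => // d t IHt x /cell_cons_sub; exact: IHt. Qed.

(** Cells are half-open and laid out by increasing rank, so a common point makes each rank at most
    the other. *)
Lemma cell_cons_disjoint d e t x : cell (d :: t) x -> cell (e :: t) x -> d = e.
Proof.
have half d' e' : cell (d' :: t) x -> cell (e' :: t) x ->
    (enum_rank d' <= enum_rank e')%N.
  move=> /cell_consP/andP[dx _] /cell_consP/andP[_ xe].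
  rewrite leqNgt; apply/negP => ed; have := le_lt_trans dx xe.
  by rewrite ltrD2l ltNge ler_wpM2l ?cell_length_ge0// le_cumul.
by move=> dx ex; apply/enum_rank_inj/val_inj/eqP; rewrite eqn_leq !half.
Qed.

Lemma cell_cover t x : cell t x -> exists d, cell (d :: t) x.
Proof.
rewrite /cell /= in_itv /= => /andP[tx xt].
pose F k := cell_start t + cell_length t * cumul t k.
have exF : exists k, x < F k by exists #|S|; rewrite /F cumul_max mulr1.
(* The least cut point beyond [x] is not the first one, which is the left end of [cell t]; its
   predecessor is the rank sought. *)
case: (ex_minnP exF) => -[|k] xk mink.
  by move: xk; rewrite /F cumul0 mulr0 addr0 ltNge tx.
have kx : F k <= x by rewrite leNgt; apply/negP => /mink; rewrite ltnn.
have kS : (k < #|S|)%N.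
  rewrite ltnNge; apply/negP => Sk; have := mink #|S|.
  rewrite /F cumul_max mulr1 => /(_ xt) kS.
  by move: (leq_trans kS Sk); rewrite ltnn.
exists (enum_val (Ordinal kS)); apply/cell_consP.
by rewrite enum_valK /= kx.
Qed.

Lemma cell_prob t : unit_prob (cell t) = (cell_length t)%:E.
Proof.
rewrite /unit_prob /mrestr setIidl; last first.
  by have := @cell_sub_unit t; rewrite /cell /= add0r.
rewrite lebesgue_measure_itv /= lte_fin ltrDl; case: ifPn => [_|].
  by rewrite -EFinB addrAC subrr add0r.
by rewrite -leNgt => l0; congr EFin; apply/eqP; rewrite eq_le cell_length_ge0.
Qed.

End Cells.

Section HistoryProcess.
Variables (R : realType) (S : finType) (q : seq S -> S -> R).
Hypothesis q_ge0 : forall t d, 0 <= q t d.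
Hypothesis sum_q : forall t, \sum_d q t d = 1.

(** The second clause holds at every point, not only almost surely, which will keep all compositions
    nonnegative. The third is the transition law multiplied out, so that null histories need no
    separate treatment. *)
Lemma history_process : exists D : nat -> measurableTypeR R -> S,
  [/\ forall n d, measurable (D n @^-1` [set d]),
      forall n w, q (history D n w) (D n w) != 0 &
      forall t d,
        unit_prob ([set w | history D (size t) w = t] `&`
                   D (size t) @^-1` [set d]) =
        ((q t d)%:E * unit_prob [set w | history D (size t) w = t])%E ].
Proof.
have [s0 _] : exists s0 : S, True.
  case: (pickP (fun _ : S => true)) => [s0 _|S0]; first by exists s0.
  by move: (sum_q [::]) => /eqP; rewrite big_pred0// eq_sym oner_eq0.
(* Points outside [[0, 1[] are sent to 0, so that every point lies in the root cell and follows a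
   chain of cells; the default [s0] is then never reached. *)
pose c (w : R) : R := if (0 <= w < 1) then w else 0.
have c_cell w : cell q [::] (c w).
  rewrite /cell /= in_itv /= add0r /c; case: ifP => //.
  by rewrite lexx ltr01.
pose h := fix h n (w : R) : seq S :=
  if n is k.+1 then
    odflt s0 [pick d | `[< cell q (d :: h k w) (c w) >]] :: h k w
  else [::].
pose D n w := head s0 (h n.+1 w).
have hD n w : history D n w = h n w by elim: n => //= n ->.
have h_cell n w : cell q (h n w) (c w).
  elim: n => [|n IHn] //=; case: pickP => [d /asboolP//|no].
  have [d hd] := cell_cover sum_q IHn.
  by have /asboolP := no d.
have hP t w : h (size t) w = t <-> cell q t (c w).
  split=> [<-//|]; elim: t => [|d t IHt]//= dt.
  have ht := IHt (cell_cons_sub q_ge0 sum_q dt).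
  have := h_cell (size t).+1 w; rewrite /= ht => hd.
  by congr (_ :: _); exact: (cell_cons_disjoint q_ge0 hd dt).
have cE t : c @^-1` cell q t `&` `[0, 1[ = cell q t.
  apply/seteqP; split => w /=; rewrite in_itv /=.
    by rewrite /c => -[+ w01]; rewrite w01.
  move=> tw; have := cell_sub_unit q_ge0 sum_q tw.
  by rewrite /cell /= in_itv /= add0r /c => w01; rewrite w01.
have cP t : unit_prob (c @^-1` cell q t) = (cell_length q t)%:E.
  rewrite -(cell_prob q_ge0 sum_q) -[in RHS]cE /unit_prob /mrestr.
  by rewrite -setIA setIid.
have mc : measurable_fun setT c.
  apply: measurable_fun_ifT => //.
  apply: measurable_and; first exact: measurable_fun_ler.
  exact: measurable_fun_ltr.
have h_event n t : size t = n ->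
    [set w | history D n w = t] = c @^-1` cell q t.
  by move=> <-; apply/seteqP; split => w /=; rewrite hD hP.
have hD_event t d : [set w | history D (size t) w = t] `&`
    D (size t) @^-1` [set d] = c @^-1` cell q (d :: t).
  rewrite -(h_event (size t).+1)//; apply/seteqP; split => w /=.
    by move=> [-> ->].
  by move=> [-> ->].
exists D; split=> [n d|n w|t d].
- have -> : D n @^-1` [set d] =
      \bigcup_(t in [set: n.-tuple S]) (c @^-1` cell q (d :: t)).
    apply/seteqP; split => w /=.
      have sh : size (h n w) == n by rewrite -hD size_history.
      move=> Dw; exists (Tuple sh) => //.
      suff : [set w' | history D (size (h n w)) w' = h n w] w /\
             (D (size (h n w)) @^-1` [set d]) w by rewrite -hD_event.
      by rewrite (eqP sh) /= hD.
    move=> [t _ tw]; suff : (D (size t) @^-1` [set d]) w by rewrite size_tuple.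
    by move: tw; rewrite -hD_event => -[].
  apply: fin_bigcup_measurable => // t _.
  by rewrite -[X in measurable X]setTI; apply: mc => //; exact: measurable_itv.
(* An extension of probability 0 would have an empty cell, yet its cell contains [c w]. *)
- have := h_cell n.+1 w; rewrite -!hD /= /cell /= in_itv /=.
  apply: contraTneq => ->; rewrite mulr0 addr0.
  by apply/negP => /andP[x1 x2]; have := le_lt_trans x1 x2; rewrite ltxx.
- by rewrite hD_event h_event// !cP muleC.
Qed.

End HistoryProcess.

Section UrnExistence.
Variables (R : realType) (s : scheme) (r m : nat).
Variables (a : sample r m -> 'rV[int]_r) (sigma : int).
Hypotheses (sigma_ge0 : 0 <= sigma) (ba : balanced a sigma) (ta : tenable s a).
Variable X0 : 'rV[int]_r.
Hypotheses (X0_ge0 : nonneg_row X0) (aX0 : admissible s m (total_balls X0)).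

Definition urn_after (t : seq (sample r m)) : 'rV[int]_r :=
  foldr (fun d x => x + a d) X0 t.

Lemma composition_history {disp : measure_display} {T : measurableType disp}
    D n (w : T) :
  composition a X0 D n w = urn_after (history D n w).
Proof.
elim: n => [|n IHn]; first by rewrite /composition big_ord0 addr0.
by rewrite compositionS IHn.
Qed.

Lemma urn_after_admissible t : admissible s m (total_balls (urn_after t)).
Proof.
elim: t => //= d t; apply: admissible_le.
by rewrite total_ballsD ba lerDl.
Qed.

(** The sets that do not separate [w] from [w'] form a sigma-algebra containing the generators.
    Hence histories of length [n] are atoms of the filtration. *)
Lemma filtration_history {disp : measure_display} {T : measurableType disp}
    (D : nat -> T -> sample r m) n w w' (A : set T) :
  history D n w = history D n w' -> draws_filtration D n A -> A w -> A w'.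
Proof.
move=> ww'.
have Dk k : (k < n)%N -> D k w = D k w'.
  elim: n ww' => //= n IHn [Dn hn]; rewrite ltnS leq_eqVlt.
  by move=> /orP[/eqP -> //|]; exact: IHn.
suff sub : draws_filtration D n `<=` [set A | A w <-> A w'].
  by move=> GA; have [] : A w <-> A w' := sub A GA.
apply: smallest_sub => [|_ [k kn [d ->]]]; last by rewrite /= Dk.
split=> /= [|B BB|B BB]; first by split.
  by split=> -[_ nB]; split=> // /BB.
by split=> -[k _ Bk]; exists k => //; apply/BB.
Qed.

Lemma urn_process_exists :
  exists (P : probability (measurableTypeR R) R) D, urn_process P s a X0 D.
Proof.
have [s0 _] : exists s0 : sample r m, True.
  case: (pickP (fun _ : sample r m => true)) => [s0 _|S0]; first by exists s0.
  move: (sum_draw_prob R aX0) => /eqP.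
  by rewrite big_pred0// eq_sym oner_eq0.
pose p t (d : sample r m) := draw_prob R s (urn_after t) d.
(* [q] must be a probability after every word, even one leading to negative counts, where a point
   mass at [s0] fills in. Tenability shows in [h_ge0] that such words never occur as histories. *)
pose q t (d : sample r m) :=
  if `[< nonneg_row (urn_after t) >] then p t d else (d == s0)%:R.
have q_ge0 t d : 0 <= q t d.
  rewrite /q; case: asboolP => // t0.
  exact: draw_prob_ge0 t0 (urn_after_admissible t).
have sum_q t : \sum_d q t d = 1.
  rewrite /q; case: asboolP => _.
    exact: sum_draw_prob (urn_after_admissible t).
  by rewrite (bigD1 s0)//= eqxx big1 ?addr0// => d /negbTE ->.
have [D [mD D_pos D_law]] := history_process q_ge0 sum_q.
have h_ge0 n w : nonneg_row (urn_after (history D n w)).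
  elim: n => // n IHn /=; apply: (@tenable_nonneg R s r m a) => //.
  by have := D_pos n w; rewrite /q asboolT.
pose E n t := [set w | history D n w = t].
have mE n t : draws_filtration D n (E n t).
  elim: n t => [|n IHn] t.
    case: t => [|d t].
      suff -> : E 0%N [::] = setT.
        exact: (@measurableT _ (g_sigma_algebraType _)).
      by apply/seteqP; split.
    suff -> : E 0%N (d :: t) = set0 by exact: sigma_algebra0.
    by apply/seteqP; split.
  case: t => [|d t].
    suff -> : E n.+1 [::] = set0 by exact: sigma_algebra0.
    by apply/seteqP; split.
  have -> : E n.+1 (d :: t) = E n t `&` D n @^-1` [set d].
    by apply/seteqP; split => w /= [] => [<- <-|<- <-].
  apply: (@measurableI _ (g_sigma_algebraType _)).
    apply: sub_sigma_algebra2 (IHn t) => _ [k kn [e ->]].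
    by exists k; [exact: ltnW|exists e].
  exact: draws_filtration_event.
exists (@unit_prob R), D; split=> // n d.
have Gm := @draws_measurable _ _ _ _ D mD n.
have mEn t := generated_measurable Gm (mE n t).
pose hist w : n.-tuple (sample r m) :=
  Tuple (introT eqP (size_history D n w)).
have histE w (t : n.-tuple (sample r m)) : (E n t w) = (hist w = t).
  by apply/propext; split=> [ht|<-//]; exact: val_inj.
(* Splitting by the history of length [n] reduces the conditional law to one atom at a time. *)
have -> : \1_(D n @^-1` [set d]) = (fun w =>
    \sum_(t : n.-tuple (sample r m))
      \1_(E n t `&` D n @^-1` [set d]) w) :> (_ -> R).
  apply/funext => w; rewrite (bigD1 (hist w))//= big1 ?addr0 => [|t /eqP tw].
    by rewrite indicI /= (indicE _ (E n _)) mem_set// mul1r.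
  by rewrite indicE memNset// => -[]; rewrite histE => /esym.
have -> : (fun w => draw_prob R s (composition a X0 D n w) d) = (fun w =>
    \sum_(t : n.-tuple (sample r m)) p t d * \1_(E n t) w).
  apply/funext => w; rewrite (bigD1 (hist w))//= big1 ?addr0 => [|t /eqP tw].
    by rewrite indicE mem_set// mulr1 composition_history.
  by rewrite indicE memNset ?mulr0//; rewrite histE => /esym.
apply: (is_cond_exp_sum Gm) => t.
have mED : measurable (E n t `&` D n @^-1` [set d]) by exact: measurableI.
split.
- exact: integrable_indic.
- exact: (integrableZl measurableT (p t d) (integrable_indic _ (mEn t))).
- apply/preimage_generatedP; apply: measurable_funM => //.
  by apply: measurable_indic; exact: mE.
- move=> A GA; have mA := generated_measurable Gm GA.
  under eq_integral do rewrite EFinM.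
  rewrite integralZl//; last first.
    exact: integrableS (integrable_indic _ (mEn t)).
  rewrite !integral_indic//.
  (* The atom either misses [A] or lies inside it; in the second case the claim is the transition
     law [D_law]. *)
  have [[w [Ew Aw]]|noA] := pselect (exists w, E n t w /\ A w); last first.
    have EA0 : E n t `&` A = set0.
      by apply/seteqP; split => // w [Ew Aw]; apply: noA; exists w.
    by rewrite setIAC EA0 set0I !measure0 mule0.
  have EA : E n t `<=` A.
    by move=> w' Ew'; apply: filtration_history GA Aw; rewrite Ew Ew'.
  rewrite setIAC (setIidl EA).
  have := D_law t d; rewrite size_tuple => Dt; apply: etrans (esym Dt).
  rewrite /q asboolT//.
  by rewrite -[tval t]Ew.
Qed.

End UrnExistence.

(** * Equivalence of linearity with the grouped sums, and the conditional mean *)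

Theorem theorem2 (R : realType) (r m : nat) (hr : (2 <= r)%N) (hm : (1 <= m)%N)
    (s : scheme) (a : sample r m -> 'rV[int]_r) (sigma : int)
    (hsigma : 0 < sigma) (hbal : balanced a sigma) (hten : tenable s a) :
  (linear_urn R s a <->
   (forall k : 'rV[int]_r, Delta m k ->
      \sum_(d : sample r m | jvec d == k) a d =
      \sum_(i < r)
        a (const_sample m i) *+ multinomial (m - 1) (k - unit_row i)))
  /\
  (linear_urn R s a ->
   forall (X0 : 'rV[int]_r) (disp : measure_display)
     (Omega : measurableType disp) (P : probability Omega R)
     (D : nat -> Omega -> sample r m),
   urn_process P s a X0 D ->
   forall n : nat,
   is_cond_exp_row P (draws_filtration D n)
     (fun w => real_row R (composition a X0 D n.+1 w))
     (fun w => real_row R (composition a X0 D n w) *m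
        (1%:M +
         ((total_balls (composition a X0 D n w))%:~R)^-1 *: reduced_mx R a))).
Proof.
(* Samples are nonempty, so a first ball [ord0] exists. *)
case: m hm a hbal hten => // m _ a hbal hten.
pose grouped := forall d : sample r m.+1, \sum_(e | jvec e == jvec d)
  (a e - a (const_sample m.+1 (e ord0))) = 0.
have mean (X0 : 'rV[int]_r) (disp : measure_display)
    (Omega : measurableType disp) (P : probability Omega R)
    (D : nat -> Omega -> sample r m.+1) : grouped ->
    urn_process P s a X0 D -> forall n : nat,
    is_cond_exp_row P (draws_filtration D n)
      (fun w => real_row R (composition a X0 D n.+1 w))
      (fun w => real_row R (composition a X0 D n w) *m
        (1%:M +
         ((total_balls (composition a X0 D n w))%:~R)^-1 *: reduced_mx R a)).
  move=> ga [X0_ge0 aX0 mD law] n i.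
  under [X in is_cond_exp _ _ _ X]funext => w.
    rewrite mulmxDr mulmx1 -scalemxAr -(mean_drift R (s := s) ga); last first.
      rewrite (total_composition X0 D n w hbal); apply: admissible_le aX0.
      by rewrite lerDl mulrn_wge0// ltW.
    rewrite mxE.
    over.
  exact: is_cond_exp_next_composition.
have linearP : linear_urn R s a <-> grouped.
  split=> [lin|ga T0 aT0]; last first.
    (* [C n] serves the [n]-th step, taken from an urn with [n.-1] past additions, hence the
       predecessor. *)
    exists (fun n => 1%:M + (T0 + sigma *+ n.-1)%:~R^-1 *: reduced_mx R a).
    move=> X0 X0_ge0 X0T disp Omega P D urn n i.
    have := mean X0 disp Omega P D ga urn n i.
    under [X in is_cond_exp _ _ _ X -> _]funext do
      rewrite (total_composition X0 D n _ hbal) X0T.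
    by [].
  apply: (linear_drift_grouped_sums (R := R) (s := s) (ltnW hr)) => T0 aT0.
  have [C CP] := lin T0 aT0.
  (* At the first step the composition is the constant [x]; integrating over the whole space
     identifies its drift with [x *m (C 1 - I)]. *)
  exists (C 1%N - 1%:M) => x x0 xT.
  have ax : admissible s m.+1 (total_balls x) by rewrite xT.
  have [P [D urn]] := urn_process_exists R (ltW hsigma) hbal hten x0 ax.
  have [_ _ mD law] := urn.
  apply/rowP => i; rewrite mulmxBr mulmx1 [RHS]mxE [X in _ = _ + X]mxE.
  have T_event : draws_filtration D 0 setT.
    exact: (@measurableT _ (g_sigma_algebraType _)).
  have [_ _ _ /(_ _ T_event)] := is_cond_exp_next_composition mD law 0 i.
  have [_ _ _ /(_ _ T_event) <-] := CP x x0 xT _ _ _ _ urn 0%N i.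
  have X0E w : composition a x D 0 w = x by rewrite /composition big_ord0 addr0.
  under eq_integral do rewrite X0E.
  under [in RHS]eq_integral do rewrite X0E.
  rewrite !integral_cst//= !probability_setT !mule1 => -[<-].
  by rewrite addrC addKr.
by rewrite grouped_sumsP; split=> // /linearP ga X0 disp Omega P D; exact: mean.
Qed.
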